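(* Let $\sigma>5$, let $T$ be a $\sigma$-HST with $n$ leaves, and let $x^0,x^1,\dots$ be the sequence of states of a fractional $k$-server algorithm on $T$, revealed online. There is an online procedure that maintains a sequence of randomized $k$-server states $S^0,S^1,\dots$ such that: (1) at every time $t$, $S^t$ is consistent with $x^t$; and (2) if the fractional state changes from $x^{t-1}$ to $x^t$ at time $t$ incurring movement cost $c_t$, then $S^{t-1}$ is modified to $S^t$ at cost $O(c_t)$ (the constant depending only on $\sigma$).
   Context: A $\sigma$-HST is a rooted tree with positive edge lengths in which all edges from a node to its children have equal length and, for each non-root internal node $p$, the edge from $p$ to its parent is exactly $\sigma$ times as long as those from $p$ to its children; the metric is the shortest-path metric on the leaves $1,\dots,n$. A fractional state is a vector $x\in[0,1]^n$ with $\sum_i x_i=k$; the movement cost of changing $x^{t-1}$ to $x^t$ is the earthmover (transportation) distance between them with respect to the tree metric. The initial fractional state $x^0$ is the $0/1$ indicator vector of the initial set of $k$ distinct leaves occupied by servers. A configuration is a set $C\subseteq\{1,\dots,n\}$ with $|C|=k$; a randomized $k$-server state $S$ is a probability distribution $\mu_S$ on configurations. $S$ is consistent with $x$ if $\sum_{C\ni i}\mu_S(C)=x_i$ for every leaf $i$. The cost of modifying a state $S$ to $S'$ is the minimum, over couplings of $\mu_S$ and $\mu_{S'}$, of the expected cost of moving servers from configuration $C$ to $C'$ (the minimum-cost matching of $C$ to $C'$ in the tree metric). Online means $S^t$ depends only on $x^0,\dots,x^t$. *)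

(* Defs.v *)
From HB Require Import structures.
From mathcomp Require Import all_boot all_order all_algebra.
From mathcomp Require Import all_classical all_reals.

Set Implicit Arguments.
Unset Strict Implicit.
Unset Printing Implicit Defensive.

Import Order.TTheory GRing.Theory Num.Theory.
Local Open Scope classical_set_scope.
Local Open Scope ring_scope.

(* Convention: [parent root = root] is a dummy value, [len v] is the length of
   the edge between [v] and [parent v], and [len root] is meaningless. *)
Record wtree (R : realType) := WTree {
  node : finType;
  root : node;
  parent : node -> node;
  len : node -> R;
  parent_root : parent root = root;
  root_reachable : forall v, exists m, iter m parent v = root;
  len_gt0 : forall v, v != root -> 0 < len v }.

Section Tree.
Context {R : realType} (T : wtree R).

Definition child_of (u p : node T) : bool := (u != root T) && (parent u == p).

Definition is_leaf (v : node T) : bool := [forall u, ~~ child_of u v].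

Definition leaf : finType := {v : node T | is_leaf v}.

Definition is_HST (sigma : R) : Prop :=
  (forall p u v : node T, child_of u p -> child_of v p -> len u = len v) /\
  (forall p u : node T, p != root T -> child_of u p -> len p = sigma * len u).

Definition adjacent (u v : node T) : bool := child_of u v || child_of v u.

Definition edge_len (u v : node T) : R := if child_of u v then len u else len v.

Definition walk_len (u : node T) (p : seq (node T)) : R :=
  \sum_(l <- pairmap edge_len u p) l.

(* Here and below minima are written [inf]; all these sets of reals are nonempty
   and bounded below by 0 in the situations considered, and the minima are
   attained. *)
Definition tree_dist (u v : node T) : R :=
  inf [set walk_len u p | p in [set p | path adjacent u p /\ last u p = v]].

Definition leaf_dist (i j : leaf) : R := tree_dist (val i) (val j).

End Tree.

Definition is_coupling (R : realType) (I : finType) (mu nu : I -> R)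
    (w : I -> I -> R) : Prop :=
  [/\ forall i j, 0 <= w i j,
      forall i, \sum_j w i j = mu i &
      forall j, \sum_i w i j = nu j].

Definition transport_cost (R : realType) (I : finType) (d : I -> I -> R)
    (mu nu : I -> R) : R :=
  inf [set \sum_i \sum_j w i j * d i j | w in is_coupling mu nu].

Section States.
Context {R : realType} (T : wtree R) (k : nat).

Definition frac_state (x : leaf T -> R) : Prop :=
  (forall i, 0 <= x i <= 1) /\ \sum_i x i = k%:R.

Definition movement_cost (x y : leaf T -> R) : R :=
  transport_cost (@leaf_dist R T) x y.

Definition indicator (C : {set leaf T}) : leaf T -> R :=
  fun i => (i \in C)%:R.

Definition initial_state (x : leaf T -> R) : Prop :=
  exists2 C : {set leaf T}, #|C| = k & x = indicator C.

Definition rand_state (mu : {set leaf T} -> R) : Prop :=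
  [/\ forall C, 0 <= mu C,
      forall C : {set leaf T}, #|C| <> k -> mu C = 0 &
      \sum_C mu C = 1].

Definition consistent (mu : {set leaf T} -> R) (x : leaf T -> R) : Prop :=
  forall i, \sum_(C : {set leaf T} | i \in C) mu C = x i.

(* [f] is only used on [C], where it is a bijection onto [C']. *)
Definition is_matching (C C' : {set leaf T}) (f : leaf T -> leaf T) : Prop :=
  {in C &, injective f} /\ f @: C = C'.

Definition matching_cost (C C' : {set leaf T}) : R :=
  inf [set \sum_(i in C) leaf_dist i (f i) | f in is_matching C C'].

Definition modification_cost (mu nu : {set leaf T} -> R) : R :=
  transport_cost matching_cost mu nu.

End States.

(* Main.v *)
Require Import Defs.
From mathcomp Require Import all_boot all_order all_algebra.
From mathcomp Require Import all_classical all_reals.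
From mathcomp Require Import perm zify ring lra.

(** Write [mass x v] for the fractional mass below the node [v]. The movement
    cost dominates the sum of [len v * |mass x v - mass y v|] over the non-root
    nodes, and the cost of matching two configurations is at most the same sum
    for their server counts. The procedure keeps its random state balanced: at
    each node the support takes at most two, consecutive, server counts.

    A balanced state for [x] is coupled with a balanced state for [y] top-down.
    The new count at [v] is [b v] or [b v + 1], where [b v <= mass y v <= b v +
    1]. Once the new count of [p] is fixed, those of its children are obtained by
    first correcting the mean of each child separately, moving all atoms in the
    same direction, and then exchanging units between atoms whose total exceeds
    the count of [p] and atoms whose total falls short of it. Hence the expected
    change of the counts of the children is at most that of [p] plus twice the
    change of the fractional masses of the children. Edge lengths shrink by a
    factor [sigma] per level, so the changes inherited from above form a
    geometric series, and the constant is [2 sigma / (sigma - 1)]. *)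

Set Implicit Arguments.
Unset Strict Implicit.
Unset Printing Implicit Defensive.

Import Order.TTheory GRing.Theory Num.Theory.
Local Open Scope ring_scope.

(* [all_algebra] shadows it with the roots of polynomials. *)
Local Notation root := Defs.root.

(** * Random subsets with given marginals *)

Section Rounding.
Context {R : realType} (V : finType).
Implicit Types (z : V -> R) (U : {set V}).

Definition set_dist (rho : {set V} -> R) z : Prop :=
  [/\ forall U, 0 <= rho U, \sum_U rho U = 1 &
      forall v, \sum_U rho U * (v \in U)%:R = z v].

(** Elements are included independently; total mass and marginals come from expanding a product of
    two-term sums. *)
Lemma product_rounding z : (forall v, 0 <= z v <= 1) ->
  exists rho, set_dist rho z.
Proof.
move=> z01.
exists (fun U => \prod_v (if v \in U then z v else 1 - z v)); split.
- move=> U; apply: prodr_ge0 => v _; have := z01 v; case: ifP => _; lra.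
- rewrite -(bigA_distr _ _ z (fun v => 1 - z v)).
  by apply: big1 => v _ /=; ring.
- move=> v.
  (* All factors with [w != v] are 1. The zero in the factor at [v] kills the sets that omit [v]
     once the product is expanded. *)
  have -> : z v = \prod_w (z w + (if w == v then 0 else 1 - z w)).
    rewrite (bigD1 v) //= eqxx addr0 big1 ?mulr1 // => w /negbTE ->.
    by ring.
  rewrite bigA_distr; apply: eq_bigr => U _.
  case: (boolP (v \in U)) => [vU|vU]; last first.
    by rewrite mulr0 (bigD1 v) //= (negbTE vU) eqxx mul0r.
  rewrite mulr1; apply: eq_bigr => w _.
  by case: ifP => // wU; case: eqP => // wv; rewrite -wv wU in vU.
Qed.

Lemma set_dist_mix rho1 rho2 z1 z2 z (l : R) : 0 <= l <= 1 ->
  set_dist rho1 z1 -> set_dist rho2 z2 ->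
  (forall v, z v = l * z1 v + (1 - l) * z2 v) ->
  set_dist (fun U => l * rho1 U + (1 - l) * rho2 U) z.
Proof.
move=> /andP[l0 l1] [p1 s1 m1] [p2 s2 m2] zE; split.
- by move=> U; rewrite addr_ge0 // mulr_ge0 // subr_ge0.
- by rewrite big_split -!mulr_sumr /= s1 s2; ring.
- move=> v; rewrite zE -m1 -m2 !mulr_sumr -big_split /=.
  by apply: eq_bigr => U _; ring.
Qed.

Definition fractional z := [set v | (0 < z v < 1)].

(** Induction on the number of fractional coordinates. An integral sum excludes exactly one of them;
    given two, shifting weight between them in either direction until one becomes integral writes
    [z] as a mixture of two vectors with the same sum and fewer fractional coordinates. *)
Lemma integral_rounding z (s : nat) : (forall v, 0 <= z v <= 1) ->
  \sum_v z v = s%:R ->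
  exists2 rho, set_dist rho z & forall U, rho U != 0 -> #|U| = s.
Proof.
have [n] := ubnP #|fractional z|; elim: n z => // n IHn z ltn z01 zs.
have z01' v : v \notin fractional z -> z v = (z v == 1)%:R.
  rewrite inE => /negP nf; have := z01 v; case: eqP => [->//|/eqP n1] /andP[a b].
  have {}b : z v < 1 by rewrite lt_neqAle n1.
  by case: (ltgtP 0 (z v)) a => // a _; case: nf; rewrite a b.
have [f0|[i fi]] := set_0Vmem (fractional z).
  have zE v : z v = (z v == 1)%:R by rewrite -z01' // f0 inE.
  exists (fun U => (U == [set v | z v == 1])%:R).
    have d1 (F : {set V} -> R) :
        \sum_U (U == [set v | z v == 1])%:R * F U = F [set v | z v == 1].
      rewrite (bigD1 [set v | z v == 1]) //= eqxx mul1r big1 ?addr0 // => U.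
      by move=> /negbTE ->; rewrite mul0r.
    split=> [U||v]; first exact: ler0n.
      by rewrite -[RHS](d1 (fun=> 1)); apply: eq_bigr => U _; rewrite mulr1.
    by rewrite (d1 (fun U => (v \in U)%:R)) inE -zE.
  move=> U; case: (U =P _) => [-> _|_]; last by rewrite eqxx.
  apply/eqP; rewrite -(eqr_nat R) -zs -sum1_card natr_sum big_mkcond.
  apply/eqP/eq_bigr => v _; rewrite inE [RHS]zE; by case: eqP.
have [j ij fj] : exists2 j, j != i & j \in fractional z.
  apply: contrapT => nj.
  (* If [i] were the only fractional coordinate, [z i] would be a difference of integers strictly
     between 0 and 1. *)
  have : z i = s%:R - (\sum_(v | v != i) (z v == 1%R))%:R.
    rewrite -zs (bigD1 i) //= natr_sum.
    have -> : \sum_(v | v != i) z v = \sum_(v | v != i) (z v == 1)%:R.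
      apply: eq_bigr => v vi; apply: z01'; apply/negP => fv.
      by apply: nj; exists v.
    by rewrite addrK.
  set c := (\sum_(v | v != i) _)%N; move: fi; rewrite inE => /andP[i0 i1] zi.
  have : (c < s)%N by rewrite -(ltr_nat R) -subr_gt0 -zi.
  rewrite -(ler_nat R) -natr1; lra.
have [i0 i1] : 0 < z i /\ z i < 1 by move: fi; rewrite inE => /andP.
have [j0 j1] : 0 < z j /\ z j < 1 by move: fj; rewrite inE => /andP.
(* The largest shifts from [j] to [i] and from [i] to [j] that stay in the unit cube; each makes one
   of the two coordinates integral. *)
pose a := Order.min (1 - z i) (z j); pose b := Order.min (z i) (1 - z j).
pose zc c v := if v == i then z i + c else if v == j then z j - c else z v.
have sumc c : \sum_v zc c v = s%:R.
  rewrite -zs (bigD1 i) // [RHS](bigD1 i) // (bigD1 j) // [in RHS](bigD1 j) //=.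
  rewrite /zc eqxx (negbTE ij) eqxx.
  rewrite (eq_bigr z); first by ring.
  by move=> v /andP[/negbTE -> /negbTE ->].
have step c : 0 <= z i + c <= 1 -> 0 <= z j - c <= 1 ->
    ~~ (0 < z i + c < 1) || ~~ (0 < z j - c < 1) ->
    exists2 rho, set_dist rho (zc c) & forall U, rho U != 0 -> #|U| = s.
  move=> ci cj cij; apply: IHn (sumc c); last first.
    by move=> v; rewrite /zc; case: eqP => // _; case: eqP.
  rewrite ltnS in ltn; apply: leq_trans ltn.
  apply: proper_card; apply/properP; split.
    apply/fintype.subsetP => v; rewrite !inE /zc.
    case: eqP => [->|_]; first by rewrite i0 i1.
    by case: eqP => [->|//]; rewrite j0 j1.
  case/orP: cij => cij; [exists i|exists j] => //; rewrite inE /zc.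
    by rewrite eqxx.
  by rewrite (negbTE ij) eqxx.
have [a0 b0] : 0 < a /\ 0 < b by rewrite /a /b; split; rewrite lt_min; lra.
have [rho1 d1 c1] : exists2 rho, set_dist rho (zc a) &
    forall U, rho U != 0 -> #|U| = s.
  by apply: step; rewrite /a; case: (leP (1 - z i) (z j)) => h; lra.
have [rho2 d2 c2] : exists2 rho, set_dist rho (zc (- b)) &
    forall U, rho U != 0 -> #|U| = s.
  by apply: step; rewrite /b; case: (leP (z i) (1 - z j)) => h; lra.
(* With these weights the shifts [a] and [- b] average to zero. *)
exists (fun U => b / (a + b) * rho1 U + (1 - b / (a + b)) * rho2 U).
  have ab : a + b != 0 by rewrite gt_eqF // addr_gt0.
  apply: set_dist_mix d1 d2 _.
    apply/andP; split; first by rewrite divr_ge0 ?ltW ?addr_gt0.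
    rewrite ler_pdivrMr ?addr_gt0 //; lra.
  by move=> v; rewrite /zc; case: eqP => [->|_]; [|case: eqP => [->|_]]; field.
move=> U; have [r1|/c1 //] := eqVneq (rho1 U) 0.
have [r2|/c2 //] := eqVneq (rho2 U) 0.
by rewrite r1 r2 !mulr0 addr0 eqxx.
Qed.

End Rounding.

(** * Correcting the counts of the children of one node *)

Section Transfer.
Context {R : realType} (A V : finType).
Variables (q : A -> R) (U : A -> {set V}) (B T : nat) (t : A -> nat).
Hypothesis q_ge0 : forall a, 0 <= q a.
Hypothesis t_bound : forall a, (T <= t a <= T.+1)%N.
Hypothesis total : \sum_a q a * (B + #|U a|)%:R = \sum_a q a * (t a)%:R.

Let e a : nat := (B + #|U a| - t a)%N.
Let d a : nat := (t a - (B + #|U a|))%N.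
Let X : R := \sum_a q a * (e a)%:R.
Let D a b := U a :\: U b.
(** A product transport plan from excess to deficit: [a] hands [e a * d b / X] units to [b], spread
    evenly over the elements of [U a] missing from [U b]. Since [X] is both the mean excess and the
    mean deficit, [a] gives away [e a] and [b] receives [d b] on average when [X] is nonzero. *)
Let h a b v : R := (e a)%:R * (d b)%:R / X * ((v \in D a b)%:R / #|D a b|%:R).
Let loss a v := \sum_b q b * h a b v.
Let gain a v := \sum_b q b * h b a v.
Let z a v := (v \in U a)%:R - loss a v + gain a v.

Let edE a : (e a)%:R - (d a)%:R = (B + #|U a|)%:R - (t a)%:R :> R.
Proof.
rewrite /e /d; case: (leqP (t a) (B + #|U a|)) => h1.
  by rewrite (eqP h1) subr0 natrB.
by rewrite (eqP (ltnW h1)) sub0r natrB ?(ltnW h1) // opprB.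
Qed.

Let XE : X = \sum_a q a * (d a)%:R.
Proof.
apply/eqP; rewrite -subr_eq0 /X -sumrB.
under eq_bigr do rewrite -mulrBr edE mulrBr.
by rewrite sumrB total subrr.
Qed.

Let X_ge0 : 0 <= X.
Proof. by apply: sumr_ge0 => a _; rewrite mulr_ge0. Qed.

(* Targets differ by at most one, so an atom above its target has at least
   [e a + d b - 1] more elements than an atom below its target. *)
Let card_D a b : (0 < e a)%N -> (0 < d b)%N ->
  (e a <= #|D a b|)%N && (d b <= #|D a b|)%N.
Proof.
have := t_bound a; have := t_bound b; rewrite /e /d /D.
have := cardsID (U b) (U a).
have := subset_leq_card (finset.subsetIr (U a) (U b)).
lia.
Qed.

Let h_ge0 a b v : 0 <= h a b v.
Proof. by rewrite /h !mulr_ge0 ?invr_ge0. Qed.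

Let sum_h a b : \sum_v h a b v = (e a)%:R * (d b)%:R / X.
Proof.
rewrite -mulr_sumr -mulr_suml.
have [e0|e0] := posnP (e a); first by rewrite e0 !mul0r.
have [d0|d0] := posnP (d b); first by rewrite d0 mulr0 !mul0r.
rewrite -natr_sum -big_mkcond sum1_card divff ?mulr1 //.
by have := card_D e0 d0; rewrite pnatr_eq0; lia.
Qed.

Let h_le_d a b v : h a b v <= (v \in U a)%:R * ((d b)%:R / X).
Proof.
rewrite /h inE; case: (v \in U a); rewrite ?andbF ?mul0r ?mulr0 // andbT mul1r.
have [e0|e0] := posnP (e a); first by rewrite e0 !mul0r divr_ge0.
have [d0|d0] := posnP (d b); first by rewrite d0 mulr0 !mul0r.
have /andP[eD _] := card_D e0 d0.
rewrite -!mulrA mulrCA ler_pM2l ?ltr0n // mulrCA ler_piMr ?invr_ge0 //.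
rewrite mulrCA -[leRHS]mul1r; apply: ler_pM => //; first by rewrite mulr_ge0 ?invr_ge0.
  by case: (_ \in _).
by rewrite ler_pdivrMr ?mul1r ?ler_nat // ltr0n (leq_trans e0).
Qed.

Let h_le_e a b v : h a b v <= (v \notin U b)%:R * ((e a)%:R / X).
Proof.
rewrite /h inE; case: (v \in U b); rewrite ?mul0r ?mulr0 //= mul1r.
have [e0|e0] := posnP (e a); first by rewrite e0 !mul0r.
have [d0|d0] := posnP (d b); first by rewrite d0 mulr0 !mul0r divr_ge0.
have /andP[_ dD] := card_D e0 d0.
rewrite -!mulrA ler_pM2l ?ltr0n // mulrCA ler_piMr ?invr_ge0 //.
rewrite mulrCA -[leRHS]mul1r; apply: ler_pM => //; first by rewrite mulr_ge0 ?invr_ge0.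
  by case: (_ \in _).
by rewrite ler_pdivrMr ?mul1r ?ler_nat // ltr0n (leq_trans d0).
Qed.

(** Covers the degenerate case too: division by zero yields 0. *)
Let XX_le1 : X / X <= 1.
Proof. by have [->|/divff ->//] := eqVneq X 0; rewrite mul0r ler01. Qed.

Let loss_bounds a v : 0 <= loss a v <= (v \in U a)%:R.
Proof.
apply/andP; split; first by apply: sumr_ge0 => b _; rewrite mulr_ge0.
apply: (@le_trans _ _ ((v \in U a)%:R * (X / X))); last by rewrite ler_piMr.
rewrite {1}XE mulr_suml mulr_sumr; apply: ler_sum => b _.
apply: le_trans (ler_wpM2l (q_ge0 b) (h_le_d a b v)) _.
by rewrite le_eqVlt; apply/orP; left; apply/eqP; ring.
Qed.

Let gain_bounds a v : 0 <= gain a v <= (v \notin U a)%:R.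
Proof.
apply/andP; split; first by apply: sumr_ge0 => b _; rewrite mulr_ge0.
apply: (@le_trans _ _ ((v \notin U a)%:R * (X / X))); last by rewrite ler_piMr.
rewrite {1}/X mulr_suml mulr_sumr; apply: ler_sum => b _.
apply: le_trans (ler_wpM2l (q_ge0 b) (h_le_e b a v)) _.
by rewrite le_eqVlt; apply/orP; left; apply/eqP; ring.
Qed.

Let sum_loss a : \sum_v loss a v = (e a)%:R * (X / X).
Proof.
rewrite exchange_big /= {1}XE mulr_suml mulr_sumr; apply: eq_bigr => b _.
by rewrite -mulr_sumr sum_h; ring.
Qed.

Let sum_gain a : \sum_v gain a v = (d a)%:R * (X / X).
Proof.
rewrite exchange_big /= {1}/X mulr_suml mulr_sumr; apply: eq_bigr => b _.
by rewrite -mulr_sumr sum_h; ring.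
Qed.

(** Each exchanged unit leaves one atom and enters another on the same element [v], so the mean at
    every [v] is preserved. An atom has an excess or a deficit but never both, so it pays at most
    its distance to the target. *)
Lemma transfer : exists w : A -> V -> R,
  [/\ forall a v, 0 <= w a v <= 1,
      forall a, q a != 0 -> B%:R + \sum_v w a v = (t a)%:R,
      forall v, \sum_a q a * w a v = \sum_a q a * (v \in U a)%:R &
      \sum_a q a * (\sum_v `|w a v - (v \in U a)%:R|) <=
      \sum_a q a * `|(B + #|U a|)%:R - (t a)%:R|].
Proof.
exists z; split=> [a v|a qa|v|].
- have := loss_bounds a v; have := gain_bounds a v; rewrite /z.
  by case: (v \in U a) => /=; lra.
- have sumU : \sum_v (v \in U a)%:R = #|U a|%:R :> R.
    by rewrite -natr_sum -big_mkcond sum1_card.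
  rewrite big_split sumrB /= sumU sum_loss sum_gain.
  have := edE a; rewrite natrD.
  (* If [X] vanishes, every atom of positive weight already meets its target. *)
  have [X0|X0] := eqVneq X 0; last by rewrite divff // !mulr1; lra.
  have z0 (c : A -> nat) : X = \sum_a q a * (c a)%:R -> (c a)%:R = 0 :> R.
    rewrite X0 => /esym/eqP; rewrite psumr_eq0 => [|b _]; last exact: mulr_ge0.
    by move=> /allP/(_ a); rewrite mem_index_enum mulf_eq0 (negbTE qa) => /(_ isT)/eqP.
  by rewrite (z0 e) // (z0 d) //; lra.
- under eq_bigr do rewrite /z mulrDr mulrBr.
  rewrite big_split sumrB /= -addrA -[RHS]addr0; congr (_ + _).
  apply/eqP; rewrite addrC subr_eq0; apply/eqP.
  rewrite /gain /loss; under eq_bigr do rewrite mulr_sumr.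
  rewrite exchange_big; apply: eq_bigr => a _ /=; rewrite mulr_sumr.
  by apply: eq_bigr => b _; rewrite mulrCA.
- apply: ler_sum => a _; apply: ler_wpM2l => //.
  apply: (@le_trans _ _ (\sum_v (loss a v + gain a v))).
    apply: ler_sum => v _.
    have -> : z a v - (v \in U a)%:R = gain a v - loss a v by rewrite /z; ring.
    have := loss_bounds a v; have := gain_bounds a v => /andP[g0 _] /andP[l0 _].
    by rewrite ler_norml; lra.
  rewrite big_split /= sum_loss sum_gain -mulrDl -edE.
  apply: (@le_trans _ _ ((e a)%:R + (d a)%:R)); first by rewrite ler_piMr ?addr_ge0.
  rewrite /e /d; case: (leqP (t a) (B + #|U a|)) => h1.
    by rewrite (eqP h1) addr0 subr0 ger0_norm.
  by rewrite (eqP (ltnW h1)) add0r sub0r normrN ger0_norm.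
Qed.

End Transfer.

(** * Correcting the mean at a single child *)

Section Column.
Context {R : realType} (O : finType).
Variables (m : O -> R) (n : O -> nat) (a b : nat) (y : R).
Hypothesis m_ge0 : forall o, 0 <= m o.
Hypothesis sum_m : \sum_o m o = 1.
Hypothesis n_bound : forall o, m o != 0 -> (a <= n o <= a.+1)%N.
Hypothesis y_bound : b%:R <= y <= b%:R + 1.

(* It suffices that all atoms move in the same direction. *)
Lemma column_correction : exists u : O -> R,
  [/\ forall o, 0 <= u o <= 1, \sum_o m o * (b%:R + u o) = y &
      \sum_o m o * `|b%:R + u o - (n o)%:R| <=
      `|y - \sum_o m o * (n o)%:R|].
Proof.
have sumC c : \sum_o m o * c = c by rewrite -mulr_suml sum_m mul1r.
(* [sg] is the common direction of the moves: with a constant sign, the mean of the absolute changes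
   is the absolute change of the mean. *)
suff [u [u01 uE [sg sgE us]]] : exists u : O -> R,
    [/\ forall o, 0 <= u o <= 1, \sum_o m o * u o = y - b%:R &
      exists2 sg : R, `|sg| = 1 & forall o, m o != 0 ->
       0 <= sg * (b%:R + u o - (n o)%:R)].
  have mE : \sum_o m o * (b%:R + u o) = y.
    under eq_bigr do rewrite mulrDr.
    by rewrite big_split /= uE sumC addrC subrK.
  exists u; split => //.
  have normE o : m o * `|b%:R + u o - (n o)%:R| =
                 sg * (m o * (b%:R + u o) - m o * (n o)%:R).
    have [->|mo] := eqVneq (m o) 0; first by ring.
    rewrite -mulrBr mulrCA; congr (_ * _).
    by rewrite -[RHS](ger0_norm (us _ mo)) normrM sgE mul1r.
  under eq_bigr do rewrite normE.
  by rewrite -mulr_sumr sumrB mE (le_trans (ler_norm _)) // normrM sgE mul1r.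
have [y0 y1] : 0 <= y - b%:R /\ y - b%:R <= 1.
  by have /andP[h1 h2] := y_bound; split; lra.
(* When [a] and [b] differ, all old counts lie on one side of the interval from [b] to [b + 1], and
   a constant [u] already moves every atom the same way. *)
have [ab|ba|ab] := ltngtP a b.
- exists (fun=> y - b%:R); split; [by move=> _; rewrite y0 y1|exact: sumC|].
  exists 1; first exact: normr1.
  move=> o /n_bound /andP[_ no]; have : (n o)%:R <= b%:R :> R by rewrite ler_nat; lia.
  lra.
- exists (fun=> y - b%:R); split; [by move=> _; rewrite y0 y1|exact: sumC|].
  exists (-1); first by rewrite normrN1.
  move=> o /n_bound /andP[no _].
  have : b.+1%:R <= (n o)%:R :> R by rewrite ler_nat; lia.
  rewrite -natr1; lra.
(* Here the old count is [b + c o], with mean [b + f]. If the mean must rise, [c] is interpolated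
   towards 1; otherwise it is scaled towards 0. *)
pose c o : R := (b < n o)%N%:R; pose f := \sum_o m o * c o.
have c01 o : 0 <= c o <= 1 by rewrite /c ler0n lern1 leq_b1.
have nE o : m o != 0 -> (n o)%:R = b%:R + c o.
  move=> /n_bound; rewrite /c ab => no; case: ltnP => h.
    by rewrite natr1; congr _%:R; lia.
  by rewrite addr0; congr _%:R; lia.
have f0 : 0 <= f by apply: sumr_ge0 => o _; rewrite mulr_ge0 //; case/andP: (c01 o).
have f1 : f <= 1.
  rewrite -sum_m; apply: ler_sum => o _; rewrite ler_piMr //; by case/andP: (c01 o).
have [fy|yf] := leP f (y - b%:R).
- have [l /andP[l0 l1] lE] : exists2 l : R, 0 <= l <= 1 & f + (1 - f) * l = y - b%:R.
    have [f_1|fn1] := eqVneq f 1; first by exists 0; lra.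
    have lt1 : 0 < 1 - f by rewrite subr_gt0 lt_neqAle fn1.
    exists ((y - b%:R - f) / (1 - f)); last by field; rewrite gt_eqF.
    apply/andP; split; first by rewrite divr_ge0 // ?subr_ge0 // ltW.
    by rewrite ler_pdivrMr //; lra.
  exists (fun o => c o + (1 - c o) * l); split.
  + move=> o; have /andP[h0 h1] := c01 o; apply/andP; split; nra.
  + rewrite -lE -[X in (X - f) * l]sum_m /f -sumrB mulr_suml -big_split /=.
    by apply: eq_bigr => o _; ring.
  + exists 1; first exact: normr1.
    by move=> o /nE ->; have /andP[h0 h1] := c01 o; nra.
- have fp : 0 < f by lra.
  have [l /andP[l0 l1] lE] : exists2 l : R, 0 <= l <= 1 & f * l = y - b%:R.
    exists ((y - b%:R) / f); last by field; rewrite gt_eqF.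
    by rewrite divr_ge0 //= ler_pdivrMr // mul1r ltW.
  exists (fun o => c o * l); split.
  + move=> o; have /andP[h0 h1] := c01 o; apply/andP; split; nra.
  + by rewrite -lE /f mulr_suml; apply: eq_bigr => o _; ring.
  + exists (-1); first by rewrite normrN1.
    by move=> o /nE ->; have /andP[h0 h1] := c01 o; nra.
Qed.

End Column.

Lemma set_dist_sum (R : realType) (V : finType) (rho : {set V} -> R) z
    (v : V) (c0 c1 : R) : set_dist rho z ->
  \sum_U rho U * (if v \in U then c1 else c0) = c0 + z v * (c1 - c0).
Proof.
move=> [_ s1 /(_ v) <-]; rewrite mulr_suml.
rewrite -[X in X + _](_ : \sum_U rho U * c0 = _); last first.
  by rewrite -mulr_suml s1 mul1r.
rewrite -big_split /=.
by apply: eq_bigr => U _; case: (v \in U) => /=; ring.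
Qed.

(* [`|_ - n|] is affine on [[b, b + 1]] because [n] is an integer. *)
Lemma set_dist_norm (R : realType) (V : finType) (rho : {set V} -> R) z
    (v : V) (b n : nat) : set_dist rho z -> 0 <= z v <= 1 ->
  \sum_U rho U * `|b%:R + (v \in U)%:R - n%:R| = `|b%:R + z v - n%:R|.
Proof.
move=> d z01; rewrite -[LHS](_ : \sum_U rho U * (if v \in U then
    `|b%:R + 1 - n%:R| else `|b%:R + 0 - n%:R|) = _); last first.
  by apply: eq_bigr => U _; case: (v \in U).
rewrite (set_dist_sum _ _ _ d) addr0; have [nb|bn] := leqP n b.
  have : n%:R <= b%:R :> R by rewrite ler_nat.
  by move=> h; rewrite !ger0_norm; lra.
have : b.+1%:R <= n%:R :> R by rewrite ler_nat.
by rewrite -natr1 => h; rewrite !ler0_norm; lra.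
Qed.

(** * Correcting all the children of a node together *)

Section Star.
Context {R : realType} (O V : finType).
Variables (m : O -> R) (n : O -> V -> nat) (a b : V -> nat) (y : V -> R).
Variables (T : nat) (t : O -> nat).
Hypothesis m_ge0 : forall o, 0 <= m o.
Hypothesis sum_m : \sum_o m o = 1.
Hypothesis n_bound : forall o v, m o != 0 -> (a v <= n o v <= (a v).+1)%N.
Hypothesis y_bound : forall v, (b v)%:R <= y v <= (b v)%:R + 1.
Hypothesis t_bound : forall o, (T <= t o <= T.+1)%N.
Hypothesis sum_t : \sum_o m o * (t o)%:R = \sum_v y v.

(** The columns are corrected one by one, rounded to sets so that [transfer] can repair the totals,
    and the result is averaged back over the rounding. The factor 2 arises because a column
    correction is paid for once by itself and once for the discrepancy it creates in the totals. *)
Lemma star_correction : exists z : O -> V -> R,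
  [/\ forall o v, 0 <= z o v <= 1,
      forall o, m o != 0 -> \sum_v ((b v)%:R + z o v) = (t o)%:R,
      forall v, \sum_o m o * ((b v)%:R + z o v) = y v &
      \sum_v \sum_o m o * `|(b v)%:R + z o v - (n o v)%:R| <=
      \sum_o m o * `|(t o)%:R - \sum_v (n o v)%:R| +
      2 * \sum_v `|y v - \sum_o m o * (n o v)%:R|].
Proof.
pose x v := \sum_o m o * (n o v)%:R.
have /choice[u' u'P] v := column_correction m_ge0 sum_m (n_bound^~ v) (y_bound v).
pose u o v := u' v o.
have /choice[rho rhoP] o : exists r, set_dist r (u o).
  by apply: product_rounding => v; case: (u'P v) => [h _ _]; exact: h.
(* Each atom [o] is split according to its rounded set; [q] weighs the refined atoms. *)
pose q (w : O * {set V}) := m w.1 * rho w.1 w.2.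
have q_ge0 w : 0 <= q w by rewrite mulr_ge0 //; case: (rhoP w.1).
pose B := (\sum_v b v)%N.
have sum_q (F : O * {set V} -> R) :
    \sum_w q w * F w = \sum_o m o * \sum_U rho o U * F (o, U).
  transitivity (\sum_w q (w.1, w.2) * F (w.1, w.2)).
    by apply: eq_bigr => -[].
  rewrite -(pair_bigA _ (fun o U => q (o, U) * F (o, U))) /=.
  by apply: eq_bigr => o _; rewrite mulr_sumr; apply: eq_bigr => U _; rewrite mulrA.
have cardE (U : {set V}) : (B + #|U|)%:R = \sum_v ((b v)%:R + (v \in U)%:R) :> R.
  by rewrite big_split /= natrD -!natr_sum -big_mkcond sum1_card.
have colq v : \sum_w q w * ((b v)%:R + (v \in w.2)%:R) = y v.
  rewrite sum_q; case: (u'P v) => _ <- _; apply: eq_bigr => o _; congr (_ * _).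
  have [_ s1 mE] := rhoP o; under eq_bigr do rewrite mulrDr.
  by rewrite big_split /= -mulr_suml s1 mul1r mE.
have total : \sum_w q w * (B + #|w.2|)%:R = \sum_w q w * (t w.1)%:R.
  have -> : \sum_w q w * (t w.1)%:R = \sum_v y v.
    rewrite sum_q -sum_t; apply: eq_bigr => o _; congr (_ * _).
    by have [_ s1 _] := rhoP o; rewrite /= -mulr_suml s1 mul1r.
  under eq_bigr do rewrite cardE mulr_sumr.
  by rewrite exchange_big; apply: eq_bigr => v _; exact: colq.
have [w [w01 wrow wcol wcost]] :=
  transfer q_ge0 (fun o => t_bound o.1) total.
exists (fun o v => \sum_U rho o U * w (o, U) v); split.
- move=> o v; have [r0 s1 _] := rhoP o; apply/andP; split.
    by apply: sumr_ge0 => U _; rewrite mulr_ge0 //; case/andP: (w01 (o, U) v).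
  rewrite -[leRHS]s1; apply: ler_sum => U _; rewrite ler_piMr //.
  by case/andP: (w01 (o, U) v).
- move=> o mo; have [r0 s1 _] := rhoP o.
  rewrite big_split /= exchange_big /= -natr_sum -/B.
  have sumC c : \sum_U rho o U * c = c by rewrite -mulr_suml s1 mul1r.
  rewrite -[X in X + _]sumC -[RHS]sumC -big_split /=.
  apply: eq_bigr => U _; rewrite -mulr_sumr -mulrDr.
  have [->|rU] := eqVneq (rho o U) 0; first by rewrite !mul0r.
  by rewrite (wrow (o, U)) // mulf_neq0.
- move=> v; rewrite -[RHS](colq v).
  under eq_bigr do rewrite mulrDr.
  under [RHS]eq_bigr do rewrite mulrDr.
  rewrite !big_split /= -wcol !sum_q; congr (_ + _).
  apply: eq_bigr => o _; have [_ s1 _] := rhoP o.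
  by rewrite -mulr_suml s1 mul1r.
(* By [set_dist_norm], rounding leaves the expected distance to an integer unchanged, so the column
   bound survives it. *)
have cost1 v : \sum_w q w * `|(b v)%:R + (v \in w.2)%:R - (n w.1 v)%:R| <=
    `|y v - x v|.
  case: (u'P v) => u01 _; apply: le_trans; rewrite sum_q; apply: ler_sum => o _.
  by rewrite /= (set_dist_norm _ _ (rhoP o)) ?u01.
have cost2 : \sum_w q w * `|(B + #|w.2|)%:R - (t w.1)%:R| <=
    \sum_o m o * `|(t o)%:R - \sum_v (n o v)%:R| + \sum_v `|y v - x v|.
  apply: (@le_trans _ _ (\sum_w q w * (`|(t w.1)%:R - \sum_v (n w.1 v)%:R| +
     \sum_v `|(b v)%:R + (v \in w.2)%:R - (n w.1 v)%:R|))).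
    apply: ler_sum => o _; rewrite ler_wpM2l // cardE.
    rewrite -[X in X <= _](_ : `|- ((t o.1)%:R - \sum_v (n o.1 v)%:R) +
       \sum_v ((b v)%:R + (v \in o.2)%:R - (n o.1 v)%:R)| = _).
      by apply: le_trans (ler_normD _ _) _; rewrite normrN lerD2l ler_norm_sum.
    by rewrite sumrB; congr `|_|; ring.
  under eq_bigr do rewrite mulrDr.
  rewrite big_split /= sum_q; apply: lerD.
    apply: ler_sum => o _; have [_ s1 _] := rhoP o.
    by rewrite /= -mulr_suml s1 mul1r.
  under eq_bigr do rewrite mulr_sumr.
  by rewrite exchange_big; apply: ler_sum => v _; exact: cost1.
(* Averaging over the rounded sets cannot increase the cost, by convexity of the absolute value. *)
apply: (@le_trans _ _ (\sum_v \sum_s q s * `|(b v)%:R + w s v - (n s.1 v)%:R|)).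
  apply: ler_sum => v _; rewrite sum_q; apply: ler_sum => o _.
  rewrite ler_wpM2l //; have [r0 s1 _] := rhoP o.
  have sumC c : \sum_U rho o U * c = c by rewrite -mulr_suml s1 mul1r.
  rewrite -[X in `|X + _ - _|]sumC -[X in `|_ - X|]sumC.
  rewrite -big_split -sumrB /=; apply: le_trans (ler_norm_sum _ _ _) _.
  apply: ler_sum => U _; rewrite -mulrDr -mulrBr normrM.
  by rewrite (ger0_norm (r0 U)).
apply: (@le_trans _ _ (\sum_v `|y v - x v| +
    \sum_s q s * (\sum_v `|w s v - (v \in s.2)%:R|))); last by lra.
under [X in _ <= _ + X]eq_bigr do rewrite mulr_sumr.
rewrite [X in _ <= _ + X]exchange_big -big_split /=; apply: ler_sum => v _.
apply: le_trans (lerD (cost1 v) (lexx _)); rewrite -big_split /=.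
apply: ler_sum => s _; rewrite -mulrDr ler_wpM2l //.
by apply: le_trans (ler_normD _ _); rewrite le_eqVlt; apply/orP; left; apply/eqP; congr `|_|; ring.
Qed.

End Star.

(** * The tree metric *)

Section TreeMetric.
Context {R : realType} (T : wtree R).
Implicit Types (u v w : node T) (i j : leaf T) (C : {set leaf T}).

Definition below u v : bool := fconnect (@parent R T) u v.

Lemma belowP u v : reflect (exists n, iter n (@parent R T) u = v) (below u v).
Proof.
apply: (iffP idP) => [uv|[n <-]]; last exact: fconnect_iter.
by exists (findex (@parent R T) u v); apply: iter_findex.
Qed.

Lemma below_refl u : below u u. Proof. exact: connect0. Qed.

Fact reaches_root v : exists n, iter n (@parent R T) v == root T.
Proof. by have [n /eqP nE] := root_reachable v; exists n. Qed.

Definition depth v : nat := ex_minn (reaches_root v).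

Lemma depth0 v : depth v = 0%N -> v = root T.
Proof. by rewrite /depth; case: ex_minnP => -[|n] //= /eqP. Qed.

Lemma iter_parent_root n : iter n (@parent R T) (root T) = root T.
Proof. by elim: n => //= n ->; rewrite parent_root. Qed.

Lemma depth_parent v : depth (parent v) = (depth v).-1.
Proof.
rewrite /depth; case: ex_minnP => a /eqP aE amin.
case: ex_minnP => b /eqP bE bmin; apply/eqP; rewrite eqn_leq; apply/andP; split.
  apply: amin; case: b bE {bmin} => [|b] /= bE.
    by rewrite bE parent_root.
  by rewrite -bE -iterSr.
have : (b <= a.+1)%N by apply: bmin; rewrite iterSr aE.
by case: b {bE bmin}.
Qed.

Lemma depth_iter n v : depth (iter n (@parent R T) v) = (depth v - n)%N.
Proof. by elim: n => [|n IHn] /=; rewrite ?subn0 // depth_parent IHn subnS. Qed.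

Lemma below_depth u v : below u v -> u != v -> (depth v < depth u)%N.
Proof.
move=> /belowP[[|n] <-]; first by rewrite eqxx.
move=> uv; rewrite depth_iter; case: (posnP (depth u)) => d; last by lia.
by move: uv; rewrite (depth0 d) iter_parent_root eqxx.
Qed.

Lemma below_root u : below u (root T).
Proof. by apply/belowP; apply: root_reachable. Qed.

Lemma below_parent u v : below (parent u) v -> below u v.
Proof. exact/connect_trans/fconnect1. Qed.

Lemma below_step u v : below u v -> u != v -> below (parent u) v.
Proof.
by move=> /belowP[[|n] <-]; rewrite ?eqxx // iterSr /below fconnect_iter.
Qed.

Lemma not_below_parent u : u != root T -> ~~ below (parent u) u.
Proof.
move=> ur; apply/negP => b; have [pu|pu] := eqVneq (parent u) u.
  have : (depth u).-1 = depth u by rewrite -depth_parent pu.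
  have : depth u != 0%N by apply: contra ur => /eqP/depth0 ->.
  lia.
have := below_depth b pu; rewrite depth_parent; lia.
Qed.

Lemma below_total u v w : below u v -> below u w -> below v w || below w v.
Proof.
move=> /belowP[a <-] /belowP[b <-]; case: (leqP a b) => ab.
  by rewrite -(subnK ab) iterD /below fconnect_iter.
by rewrite -(subnK (ltnW ab)) iterD /below fconnect_iter orbT.
Qed.

Lemma below_child u v : below u v -> u != v ->
  exists2 w, child_of w v & below u w.
Proof.
move=> /belowP[n]; elim: n => [|n IHn] /= vE; first by rewrite vE eqxx.
have [wr|wr] := eqVneq (iter n (@parent R T) u) (root T).
  by apply: IHn; rewrite wr -vE wr parent_root.
by exists (iter n (@parent R T) u); [rewrite /child_of wr vE eqxx|exact: fconnect_iter].
Qed.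

Lemma below_child_uniq u v w w' : child_of w v -> child_of w' v ->
  below u w -> below u w' -> w = w'.
Proof.
have aux s s' : child_of s v -> child_of s' v -> below s s' -> s = s'.
  move=> /andP[_ /eqP sv] /andP[s'r /eqP s'v] ss'; apply/eqP/negP => /negP ne.
  by move: (not_below_parent s'r); rewrite s'v -sv below_step.
move=> wv w'v uw uw'; case/orP: (below_total uw uw'); first exact: aux.
by move=> /(aux _ _ w'v wv).
Qed.

(** The tree distance in closed form: the edge above [w] separates [u] from [v] exactly when one of
    them is below [w] and the other is not. *)
Definition sep u v : R :=
  \sum_(w | w != root T) len w * `|(below u w)%:R - (below v w)%:R|.

Lemma len_ge0 w : w != root T -> 0 <= len w.
Proof. by move/len_gt0/ltW. Qed.

Lemma sep_ge0 u v : 0 <= sep u v.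
Proof. by apply: sumr_ge0 => w wr; rewrite mulr_ge0 ?len_ge0. Qed.

Lemma sepxx u : sep u u = 0.
Proof. by apply: big1 => w _; rewrite subrr normr0 mulr0. Qed.

Lemma sepC u v : sep u v = sep v u.
Proof. by apply: eq_bigr => w _; rewrite distrC. Qed.

Lemma sep_triangle u v w : sep u w <= sep u v + sep v w.
Proof.
rewrite -big_split /=; apply: ler_sum => s sr; rewrite -mulrDr ler_wpM2l ?len_ge0 //.
exact: ler_distD.
Qed.

Lemma below_edge u w : u != root T ->
  (below u w)%:R - (below (parent u) w)%:R = (w == u)%:R :> R.
Proof.
move=> ur; have [->|wu] := eqVneq w u.
  by rewrite below_refl (negbTE (not_below_parent ur)) subr0.
suff -> : below u w = below (parent u) w by rewrite subrr.
apply/idP/idP; last exact: below_parent.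
by move/below_step; apply; rewrite eq_sym.
Qed.

Lemma sep_step u v : u != root T -> ~~ below v u ->
  sep u v = len u + sep (parent u) v.
Proof.
move=> ur vu; rewrite /sep (bigD1 u) //= [X in _ = _ + X](bigD1 u) //= addrA.
congr (_ + _).
  by rewrite below_refl (negbTE vu) (negbTE (not_below_parent ur)) subr0 normr1 subrr normr0; ring.
apply: eq_bigr => w /andP[_ /negbTE wu]; have := below_edge w ur.
by rewrite wu => /eqP; rewrite subr_eq0 => /eqP ->.
Qed.

Lemma child_asym u v : child_of u v -> ~~ child_of v u.
Proof.
move=> /andP[ur /eqP uv]; apply/negP => /andP[_ /eqP vu].
by move: (not_below_parent ur); rewrite uv -[X in below v X]vu /below fconnect1.
Qed.

Lemma sep_child u v : child_of u v -> sep u v = len u.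
Proof.
move=> /andP[ur /eqP <-].
by rewrite sep_step ?not_below_parent // sepxx addr0.
Qed.

Lemma sep_adjacent u v : adjacent u v -> sep u v = edge_len u v.
Proof.
rewrite /edge_len => /orP[uv|vu]; first by rewrite uv sep_child.
by rewrite (negbTE (child_asym vu)) sepC sep_child.
Qed.

Lemma walk_len_cons u v (p : seq (node T)) :
  walk_len u (v :: p) = edge_len u v + walk_len v p.
Proof. by rewrite /walk_len /= big_cons. Qed.

Lemma walk_len_rcons u v (p : seq (node T)) :
  walk_len u (rcons p v) = walk_len u p + edge_len (last u p) v.
Proof.
elim: p u => [|w p IHp] u /=; rewrite ?walk_len_cons ?IHp ?addrA //.
by rewrite /walk_len /= !big_nil addrC.
Qed.

Lemma sep_le_walk u (p : seq (node T)) :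
  path (@adjacent R T) u p -> sep u (last u p) <= walk_len u p.
Proof.
elim: p u => [|v p IHp] u /=; first by rewrite /walk_len /= big_nil sepxx.
move=> /andP[uv /IHp h]; rewrite walk_len_cons -sep_adjacent //.
by apply: le_trans (sep_triangle _ v _) _; rewrite lerD2l.
Qed.

(** Induction on the sum of the depths: replacing the deeper endpoint by its parent removes exactly
    one separating edge. *)
Lemma sep_walk u v : exists p : seq (node T),
  [/\ path (@adjacent R T) u p, last u p = v & walk_len u p = sep u v].
Proof.
have [n] := ubnP (depth u + depth v); elim: n u v => // n IHn u v ltn.
have [<-|uv] := eqVneq u v.
  by exists [::]; split=> //; rewrite /walk_len big_nil sepxx.
have [d|d] := leqP (depth v) (depth u).
  have ur : u != root T.
    apply/eqP => ur; move: d uv; rewrite ur -{2}(iter_parent_root 0).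
    have -> : depth (root T) = 0%N.
      rewrite /depth; case: ex_minnP => a _ /(_ 0%N); rewrite eqxx.
      by move=> /(_ isT); rewrite leqn0 => /eqP.
    by rewrite leqn0 => /eqP/depth0 ->; rewrite eqxx.
  have d0 : (0 < depth u)%N by case: posnP => // /depth0 e; rewrite e eqxx in ur.
  have [|p [pp pl pw]] := IHn (parent u) v.
    rewrite depth_parent; lia.
  have up : child_of u (parent u) by rewrite /child_of ur eqxx.
  exists (parent u :: p); split=> //=; first by rewrite /adjacent up pp.
  rewrite walk_len_cons pw /edge_len up [RHS]sep_step //.
  apply/negP => /below_depth; rewrite eq_sym => /(_ uv); lia.
have vr : v != root T.
  apply/eqP => vr; move: (below_depth (below_root u)); rewrite -vr => /(_ uv); lia.
have [|p [pp pl pw]] := IHn u (parent v).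
  rewrite depth_parent; lia.
have vp : child_of v (parent v) by rewrite /child_of vr eqxx.
exists (rcons p v); split; rewrite ?last_rcons //.
  by rewrite rcons_path pp pl /adjacent vp orbT.
rewrite walk_len_rcons pw pl /edge_len (negbTE (child_asym vp)).
have nuv : ~~ below u v by apply/negP => /below_depth => /(_ uv); lia.
by rewrite [RHS]sepC (sep_step vr nuv) addrC sepC.
Qed.

Lemma tree_dist_sep u v : tree_dist u v = sep u v.
Proof.
have [p [pp pl pw]] := sep_walk u v.
apply/eqP; rewrite eq_le; apply/andP; split.
  rewrite -pw; apply: ge_inf; last by exists p.
  by exists 0 => _ [s [sp sl] <-]; apply: le_trans (sep_le_walk sp); apply: sep_ge0.
apply: lb_le_inf; first by exists (walk_len u p), p.
by move=> _ [s [sp sl] <-]; rewrite -sl; exact: sep_le_walk.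
Qed.

End TreeMetric.

(** * Bounds on transport costs *)

Section Transport.
Context {R : realType} (I : finType).
Implicit Types (d : I -> I -> R) (mu nu : I -> R).

Lemma transport_cost_le d mu nu w : (forall i j, 0 <= d i j) ->
  is_coupling mu nu w -> transport_cost d mu nu <= \sum_i \sum_j w i j * d i j.
Proof.
move=> d0 cw; apply: ge_inf; last by exists w.
exists 0 => _ [s [s0 _ _] <-]; apply: sumr_ge0 => i _; apply: sumr_ge0 => j _.
exact: mulr_ge0.
Qed.

Lemma le_transport_cost d mu nu c :
  (forall i, 0 <= mu i) -> (forall i, 0 <= nu i) ->
  \sum_i mu i = \sum_i nu i ->
  (forall w, is_coupling mu nu w -> c <= \sum_i \sum_j w i j * d i j) ->
  c <= transport_cost d mu nu.
Proof.
move=> mu0 nu0 eqs h; apply: lb_le_inf; last by move=> _ [w cw <-]; apply: h.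
(* The product coupling, normalised by the common total; if [s] is 0, both measures vanish. *)
pose s := \sum_i mu i; pose w i j := mu i * nu j / s.
suff cw : is_coupling mu nu w by exists (\sum_i \sum_j w i j * d i j), w.
have s0 : 0 <= s by apply: sumr_ge0.
have z0 (f : I -> R) i : (forall i, 0 <= f i) -> \sum_i f i = s -> s = 0 -> f i = 0.
  move=> f0 fs s00; move/eqP: fs; rewrite s00 psumr_eq0 // => /allP/(_ i).
  by rewrite mem_index_enum => /(_ isT)/eqP.
split=> [i j|i|j]; first by rewrite /w divr_ge0 ?mulr_ge0.
  rewrite /w -mulr_suml -mulr_sumr -eqs -/s -mulrA.
  have [s00|sn0] := eqVneq s 0; last by rewrite divff ?mulr1.
  by rewrite (z0 mu i) ?mul0r.
rewrite /w -!mulr_suml -/s mulrAC.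
have [s00|sn0] := eqVneq s 0; last by rewrite divff ?mul1r.
by rewrite (z0 nu j) ?mulr0 // -eqs.
Qed.

End Transport.

(** * Subtree masses, movement cost and matching cost *)

Section Mass.
Context {R : realType} (T : wtree R).
Implicit Types (u v w p : node T) (i j : leaf T) (C : {set leaf T}).
Implicit Types (f g x y : leaf T -> R).

Definition mass f v : R := \sum_(i | below (val i) v) f i.

Lemma massE f v : mass f v = \sum_i f i * (below (val i) v)%:R.
Proof.
rewrite /mass big_mkcond; apply: eq_bigr => i _.
by case: ifP => _; rewrite ?mulr1 ?mulr0.
Qed.

Lemma mass_ge0 f v : (forall i, 0 <= f i) -> 0 <= mass f v.
Proof. by move=> f0; apply: sumr_ge0. Qed.

Lemma mass_root f : mass f (root T) = \sum_i f i.
Proof. by apply: eq_bigl => i; rewrite below_root. Qed.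

Lemma mass_leaf f i : mass f (val i) = f i.
Proof.
rewrite /mass (big_pred1 i) // => j /=; apply/idP/eqP => [b|->]; last exact: below_refl.
apply/val_inj/eqP/negPn/negP => ne; have [w wi _] := below_child b ne.
by have /forallP/(_ w) := valP i; rewrite wi.
Qed.

Lemma mass_children f p : ~~ is_leaf p ->
  mass f p = \sum_(v | child_of v p) mass f v.
Proof.
move=> np; rewrite /mass (exchange_big_dep (fun i => below (val i) p)) /=; last first.
  by move=> v i /andP[_ /eqP <-] iv; exact: connect_trans iv (fconnect1 _ _).
apply: eq_bigr => i ip.
have ne : val i != p by apply: contraNneq np => <-; exact: valP.
have [w wp iw] := below_child ip ne; rewrite (big_pred1 w) // => v /=.
apply/andP/eqP => [[vp iv]|->//]; exact: below_child_uniq vp wp iv iw.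
Qed.

Definition cnt C v : nat := #|[set i in C | below (val i) v]|.

Lemma cntE C v : (cnt C v)%:R = mass (indicator C) v.
Proof.
rewrite massE /cnt -sum1_card natr_sum big_mkcond; apply: eq_bigr => i _.
by rewrite inE /indicator; case: (i \in C); case: (below _ _); rewrite /= ?mulr0 ?mul0r ?mulr1.
Qed.

Lemma cnt_root C : cnt C (root T) = #|C|.
Proof. by apply: eq_card => i; rewrite inE below_root andbT. Qed.

(** The usual flow formula for the earthmover distance on a tree: the edge above [v] must carry the
    net change of mass below [v]. *)
Definition tree_norm x y : R :=
  \sum_(v | v != root T) len v * `|mass x v - mass y v|.

(** In any coupling, the net flow through an edge is at most the gross flow. *)
Lemma tree_norm_le_movement k x y : frac_state k x -> frac_state k y ->
  tree_norm x y <= movement_cost x y.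
Proof.
move=> [x01 xk] [y01 yk]; apply: le_transport_cost => [i|i||w [w0 wx wy]].
- by case/andP: (x01 i).
- by case/andP: (y01 i).
- by rewrite xk yk.
under eq_bigr do under eq_bigr do rewrite /leaf_dist tree_dist_sep mulr_sumr.
under eq_bigr do rewrite exchange_big /=.
rewrite exchange_big; apply: ler_sum => v vr /=.
have -> : mass x v - mass y v = \sum_i \sum_j w i j *
    ((below (val i) v)%:R - (below (val j) v)%:R).
  rewrite !massE.
  under eq_bigr do rewrite -wx mulr_suml.
  under [X in _ - X]eq_bigr do rewrite -wy mulr_suml.
  rewrite [X in _ - X]exchange_big -sumrB; apply: eq_bigr => i _ /=.
  by rewrite -sumrB; apply: eq_bigr => j _; rewrite mulrBr.
rewrite (le_trans (ler_wpM2l (len_ge0 vr) (ler_norm_sum _ _ _))) //.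
rewrite mulr_sumr; apply: ler_sum => i _.
rewrite (le_trans (ler_wpM2l (len_ge0 vr) (ler_norm_sum _ _ _))) //.
rewrite mulr_sumr; apply: ler_sum => j _.
by rewrite normrM (ger0_norm (w0 i j)) mulrCA.
Qed.

Lemma matching_cost_ge0 C C' : 0 <= matching_cost C C'.
Proof.
rewrite /matching_cost; set S := (X in inf X).
have [->|/set0P S0] := eqVneq S set0; first by rewrite inf0.
apply: lb_le_inf => // _ [f _ <-]; apply: sumr_ge0 => i _.
by rewrite /leaf_dist tree_dist_sep sep_ge0.
Qed.

(** Finite functions allow a cheapest matching to be selected; injectivity on [C] follows from equal
    cardinalities. *)
Lemma matching_exists C C' : #|C| = #|C'| ->
  exists f : {ffun leaf T -> leaf T}, f @: C == C'.
Proof.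
move=> cE; have [C0|[i0 i0C]] := set_0Vmem C.
  exists [ffun i => i]; rewrite C0 imset0 eq_sym -cards_eq0 -cE C0 cards0 //.
have [j0 j0C] : exists j0, j0 \in C'.
  by apply/card_gt0P; rewrite -cE; apply/card_gt0P; exists i0.
exists [ffun i => nth j0 (enum C') (index i (enum C))].
rewrite eqEcard; apply/andP; split.
  apply/fintype.subsetP => _ /imsetP[i iC ->]; rewrite ffunE -mem_enum mem_nth //.
  by rewrite -cardE -cE cardE index_mem mem_enum.
rewrite -cE card_in_imset // => i i' iC i'C; rewrite !ffunE => /eqP.
rewrite nth_uniq ?enum_uniq -?cardE -?cE ?cardE ?index_mem ?mem_enum //.
move=> /eqP/(congr1 (nth i0 (enum C))); rewrite !nth_index ?mem_enum //.
Qed.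

Let B i v : R := (below (val i) v)%:R.

(* If a matched pair leaves the subtree of [v] and another enters it, exchanging
   their targets shortens the matching. *)
Lemma uncross i j i' j' v : v != root T ->
  below (val i) v -> ~~ below (val i') v -> ~~ below (val j) v ->
  below (val j') v ->
  sep (val i) (val j') + sep (val j) (val i') <
  sep (val i) (val i') + sep (val j) (val j').
Proof.
move=> vr iv i'v jv j'v; rewrite /sep -!big_split /=.
(* The swap is no worse at any edge, whether the subtree of [w] contains that of [v], lies inside it
   or is disjoint from it; at [v] itself it is strictly better. *)
have leB w : w != root T ->
   `|B i w - B j' w| + `|B j w - B i' w| <= `|B i w - B i' w| + `|B j w - B j' w|.
  move=> wr; rewrite /B.
  have tr (s : leaf T) : below (val s) v -> below (val s) w -> below v w \/ below w v.
    by move=> a b; case/orP: (below_total a b); [left|right].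
  have up : below v w -> below (val i) w /\ below (val j') w.
    by move=> vw; split; apply: connect_trans vw.
  have dn (s : leaf T) : below w v -> ~~ below (val s) v -> below (val s) w = false.
    by move=> wv; apply: contraNF => sw; exact: connect_trans wv.
  case: (boolP (below v w)) => vw.
    have [-> ->] := up vw; rewrite subrr normr0 add0r.
    by case: (below (val j) w); case: (below (val i') w);
      rewrite ?subrr ?subr0 ?sub0r ?normrN ?normr0 ?normr1 ?addr0 ?add0r //; lra.
  case: (boolP (below w v)) => wv.
    rewrite (dn i') // (dn j) // subrr normr0 addr0.
    by case: (below (val i) w); case: (below (val j') w);
      rewrite ?subrr ?subr0 ?sub0r ?normrN ?normr0 ?normr1 ?addr0 ?add0r //; lra.
  have no (s : leaf T) : below (val s) v -> below (val s) w = false.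
    by move=> sv; apply/negP => /(tr s sv) []; apply/negP.
  rewrite (no i) // (no j') // subrr normr0 add0r.
  by case: (below (val j) w); case: (below (val i') w);
    rewrite ?subrr ?subr0 ?sub0r ?normrN ?normr0 ?normr1 ?addr0 ?add0r //; lra.
rewrite (bigD1 v) //= [ltRHS](bigD1 v) //=; apply: ltr_leD.
  rewrite -!mulrDr ltr_pM2l ?len_gt0 // iv j'v (negbTE i'v) (negbTE jv).
  by rewrite !subrr subr0 sub0r normrN normr0 normr1; lra.
by apply: ler_sum => w /andP[wr _]; rewrite -!mulrDr ler_wpM2l ?len_ge0 // leB.
Qed.

(** By [uncross], a cheapest matching never crosses an edge in both directions, so its gross flow
    through each edge equals the net flow. *)
Lemma matching_cost_le C C' : #|C| = #|C'| ->
  matching_cost C C' <= tree_norm (indicator C) (indicator C').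
Proof.
move=> cE; have [f0 f0P] := matching_exists cE.
pose cost (f : {ffun leaf T -> leaf T}) := \sum_(i in C) sep (val i) (val (f i)).
case: (@Order.TotalTheory.arg_minP _ _ _ f0 (fun h : {ffun _ -> _} => h @: C == C') cost f0P) =>
  f /eqP fC fmin.
have finj : {in C &, injective f} by apply/imset_injP; rewrite fC cE.
apply: (@le_trans _ _ (cost f)).
  apply: ge_inf; last first.
    by exists f => //; apply: eq_bigr => i _; rewrite /leaf_dist tree_dist_sep.
  exists 0 => _ [g _ <-]; apply: sumr_ge0 => i _.
  by rewrite /leaf_dist tree_dist_sep sep_ge0.
rewrite /cost /sep exchange_big; apply: ler_sum => v vr /=.
rewrite -mulr_sumr ler_wpM2l ?len_ge0 //.
have -> : mass (indicator C) v - mass (indicator C') v =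
    \sum_(i in C) (B i v - B (f i) v).
  have mC D : mass (indicator D) v = \sum_(i in D) B i v.
    rewrite massE [RHS]big_mkcond; apply: eq_bigr => i _.
    by rewrite /indicator; case: (i \in D); rewrite ?mul1r ?mul0r.
  by rewrite !mC -fC big_imset //= -sumrB.
have same_sign : (forall i, i \in C -> B (f i) v <= B i v) \/
                 (forall i, i \in C -> B i v <= B (f i) v).
  have [h|] := pselect (forall i, i \in C -> B (f i) v <= B i v); first by left.
  move=> /existsNP[j /not_implyP[jC /negP]]; rewrite -ltNge ltr_nat => jv.
  right => i iC; rewrite leNgt ltr_nat; apply/negP => iv.
  have [i1 i0] : below (val i) v /\ ~~ below (val (f i)) v.
    by move: iv; do 2!case: (below _ _).
  have [j1 j0] : ~~ below (val j) v /\ below (val (f j)) v.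
    by move: jv; do 2!case: (below _ _).
  have ij : j != i by apply: contraNneq j1 => ->.
  pose g := [ffun s => f (tperm i j s)].
  have gC : g @: C == C'.
    rewrite eqEcard -cE; apply/andP; split.
      apply/fintype.subsetP => _ /imsetP[s sC ->]; rewrite ffunE -fC imset_f //.
      by case: tpermP => // ->.
    rewrite card_in_imset // => s s' sC s'C; rewrite !ffunE => /finj e.
    by apply: (@perm_inj _ (tperm i j)); apply: e; case: tpermP => // ->.
  have := fmin g gC; rewrite leNgt => /negP; apply.
  rewrite /cost (bigD1 i) // [ltRHS](bigD1 i) // (bigD1 j) /= ?jC //.
  rewrite [X in _ < _ + X](bigD1 j) /= ?jC // !addrA !ffunE tpermL tpermR.
  apply: ltr_leD; first exact: uncross i1 i0 j1 j0.
  rewrite le_eqVlt; apply/orP; left; apply/eqP; apply: eq_bigr => s /andP[/andP[_ si] sj].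
  by rewrite ffunE tpermD // eq_sym.
case: same_sign => h.
  rewrite ger0_norm; last by apply: sumr_ge0 => i iC; rewrite subr_ge0 h.
  by apply: ler_sum => i iC; rewrite ger0_norm // subr_ge0 h.
rewrite ler0_norm -?sumrN; last first.
  by rewrite sumr_le0 // => i iC; rewrite subr_le0 h.
by apply: ler_sum => i iC; rewrite ler0_norm // subr_le0 h.
Qed.

End Mass.

(** * Coupling two balanced states *)

Section Step.
Context {R : realType} (T : wtree R) (k : nat).
Variables (x y : leaf T -> R) (mu : {set leaf T} -> R) (a b : node T -> nat).
Hypothesis y_state : frac_state k y.
Hypothesis mu_state : rand_state k mu.
Hypothesis mu_x : consistent mu x.
Hypothesis mu_bal : forall C v, mu C != 0 -> (a v <= cnt C v <= (a v).+1)%N.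
Hypothesis b_bound : forall v, (b v)%:R <= mass y v <= (b v)%:R + 1.
Hypothesis b_leaf : forall v, is_leaf v -> b v = 0%N.

Let O := ({set leaf T} * {set node T})%type.
Implicit Types (o : O) (W : O -> R) (P : {set node T}) (v p : node T).

(* An atom [(C, U)] stands for the old configuration [C] coupled with the new
   counts [b v + (v \in U)], which are meaningful only at the nodes that the
   top-down construction has already reached. *)
Definition new_cnt o v : nat := (b v + (v \in o.2))%N.

Definition dev W v : R := \sum_o W o * `|(new_cnt o v)%:R - (cnt o.1 v)%:R|.

Definition reached P v : Prop := v = root T \/ parent v \in P.

(** [P] collects the internal nodes whose new count has already been distributed among their
    children. The last clause is the local cost bound that [coupling_cost] sums over the tree. *)
Definition partial_coupling W P : Prop :=
  [/\ (forall o, 0 <= W o) /\ (forall C, \sum_U W (C, U) = mu C),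
      forall p, p \in P -> reached P p,
      forall v, reached P v -> \sum_o W o * (new_cnt o v)%:R = mass y v,
      forall o, W o != 0 -> new_cnt o (root T) = k /\
        (forall p, p \in P ->
           (\sum_(v | child_of v p) new_cnt o v)%N = new_cnt o p) &
      forall p, p \in P -> \sum_(v | child_of v p) dev W v <=
        dev W p + 2 * \sum_(v | child_of v p) `|mass y v - mass x v|].

Let sumO (F : O -> R) : \sum_o F o = \sum_C \sum_U F (C, U).
Proof. by rewrite pair_bigA; apply: eq_bigr => -[]. Qed.

Let sum_marginal W (F : {set leaf T} -> R) :
  (forall C, \sum_U W (C, U) = mu C) ->
  \sum_o W o * F o.1 = \sum_C mu C * F C.
Proof.
by move=> Wmu; rewrite sumO; apply: eq_bigr => C _; rewrite /= -mulr_suml Wmu.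
Qed.

Lemma mean_cnt v : \sum_C mu C * (cnt C v)%:R = mass x v.
Proof.
rewrite massE; under eq_bigr do rewrite cntE massE mulr_sumr.
rewrite exchange_big; apply: eq_bigr => i _ /=.
rewrite -mu_x mulr_suml [RHS]big_mkcond; apply: eq_bigr => C _.
by rewrite /indicator; case: (i \in C); rewrite ?mul1r ?mul0r ?mulr0.
Qed.

Lemma partial_coupling_support W P o : partial_coupling W P ->
  W o != 0 -> mu o.1 != 0.
Proof.
move=> [[W0 Wmu] _ _ _ _]; apply: contra_neq => m0.
have := Wmu o.1; rewrite m0 => /psumr_eq0P h.
by have := h (fun _ _ => W0 _) o.2 isT; case: o {m0 h}.
Qed.

Lemma partial_coupling0 : exists W, partial_coupling W finset.set0.
Proof.
have [mu0 muk mu1] := mu_state.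
(* The mass at the root is the integer [k], so [b (root T)] is [k] or [k - 1]; [U0] supplies the
   missing unit in the second case. *)
pose U0 := [set v | (v == root T) && (b (root T) != k)].
have rootk : (b (root T) + (root T \in U0))%N = k.
  have := b_bound (root T); rewrite mass_root y_state.2 natr1 !ler_nat inE eqxx.
  by case: eqVneq => /=; lia.
pose W o := mu o.1 * (o.2 == U0)%:R.
have sumU C (F : {set node T} -> R) : \sum_U W (C, U) * F U = mu C * F U0.
  rewrite (bigD1 U0) //= big1 /W /= ?eqxx ?mulr1 ?addr0 // => U /negbTE ->.
  by rewrite mulr0 mul0r.
have Wmu C : \sum_U W (C, U) = mu C.
  rewrite -[RHS]mulr1 -(sumU C (fun=> 1)).
  by apply: eq_bigr => U _; rewrite mulr1.
exists W; split; rewrite ?finset.in_set0 //.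
- by split=> // o; rewrite mulr_ge0.
- by move=> p; rewrite finset.in_set0.
- move=> v [->|]; last by rewrite finset.in_set0.
  rewrite sumO; under eq_bigr do rewrite (sumU _ (fun U => (b _ + (_ \in U))%:R)).
  by rewrite -mulr_suml mu1 mul1r rootk mass_root y_state.2.
- move=> [C U]; rewrite /W /=; case: (U =P U0) => [->|_]; last by rewrite mulr0 eqxx.
  by move=> _; split=> [|p]; rewrite ?finset.in_set0.
- by move=> p; rewrite finset.in_set0.
Qed.

(** [star_correction] gives each atom fractional counts at the children of [p] with total
    [new_cnt o p]; [integral_rounding] then splits the atom while keeping that total exact. No child
    of [p] was reached before, so earlier clauses are unaffected. *)
Lemma partial_coupling_step W P p : partial_coupling W P ->
  p \notin P -> ~~ is_leaf p -> reached P p ->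
  exists W', partial_coupling W' (p |: P).
Proof.
move=> WP pP np rp; have [[W0 Wmu] Pcl Wmean Wsupp Wcost] := WP.
have [mu0 muk mu1] := mu_state.
have not_child v : reached P v -> child_of v p = false.
  case=> [->|vP]; first by rewrite /child_of eqxx.
  by apply: contraNF pP => /andP[_ /eqP <-].
have sumW : \sum_o W o = 1.
  rewrite -mu1 sumO; exact: eq_bigr.
(* The data are extended by zero from the children of [p] to all nodes; the zero means then force
   [z] to vanish off the children on atoms of positive weight. *)
pose n o v := if child_of v p then cnt o.1 v else 0%N.
pose a' v := if child_of v p then a v else 0%N.
pose b' v := if child_of v p then b v else 0%N.
pose y' v : R := if child_of v p then mass y v else 0.
have nbound o v : W o != 0 -> (a' v <= n o v <= (a' v).+1)%N.
  move=> /(partial_coupling_support WP); rewrite /a' /n.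
  by case: (child_of v p) => // /mu_bal.
have ybound v : (b' v)%:R <= y' v <= (b' v)%:R + 1.
  rewrite /b' /y'; case: (child_of v p) => //; lra.
have tbound o : (b p <= new_cnt o p <= (b p).+1)%N.
  by rewrite /new_cnt; case: (p \in _) => /=; lia.
have sumt : \sum_o W o * (new_cnt o p)%:R = \sum_v y' v.
  by rewrite Wmean // mass_children // big_mkcond.
have [z [z01 zrow zcol zcost]] :=
  star_correction W0 sumW nbound ybound tbound sumt.
have z_nchild o v : W o != 0 -> ~~ child_of v p -> z o v = 0.
  move=> Wo nv; have := zcol v; rewrite /b' /y' (negbTE nv) => /psumr_eq0P h.
  have : W o * (0%:R + z o v) = 0.
    by apply: h => // o' _; rewrite add0r mulr_ge0 //; case/andP: (z01 o' v).
  by rewrite add0r => /eqP; rewrite mulf_eq0 (negbTE Wo) => /eqP.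
have /choice[rho rhoP] o : exists r, set_dist r (z o) /\
    (W o != 0 -> forall U, r U != 0 ->
       (\sum_(v | child_of v p) (b v + (v \in U)))%N = new_cnt o p).
  have [W_0|Wo] := eqVneq (W o) 0.
    by have [r rP] := product_rounding (z01 o); exists r.
  have sb : (\sum_v b' v <= new_cnt o p)%N.
    rewrite -(ler_nat R) -zrow // big_split /= natr_sum lerDl.
    by apply: sumr_ge0 => v _; case/andP: (z01 o v).
  have sz : \sum_v z o v = (new_cnt o p - \sum_v b' v)%:R.
    by rewrite natrB // -zrow // big_split /= natr_sum addrAC subrr add0r.
  have [r rP rc] := integral_rounding (z01 o) sz; exists r; split=> // _ U rU.
  have Uch v : v \in U -> child_of v p.
    move=> vU; apply: contraT => nv; have [r0 _ /(_ v)] := rP.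
    rewrite z_nchild // => /psumr_eq0P h.
    have /eqP : r U * (v \in U)%:R = 0 by apply: h => // U' _; rewrite mulr_ge0.
    by rewrite vU mulr1 (negbTE rU).
  rewrite -(subnKC sb) -(rc _ rU) big_split /= -big_mkcond; congr (_ + _)%N.
  rewrite -sum1_card [RHS]big_mkcond [LHS]big_mkcond; apply: eq_bigr => v _.
  by case: (boolP (v \in U)) => [/Uch -> //|_]; case: ifP.
pose merge (U U' : {set node T}) :=
  [set v | if child_of v p then v \in U' else v \in U].
pose W' o := \sum_U W (o.1, U) * \sum_U' rho (o.1, U) U' * (merge U U' == o.2)%:R.
have sumW' (C : {set leaf T}) (F : {set node T} -> R) :
    \sum_U W' (C, U) * F U =
    \sum_U W (C, U) * \sum_U' rho (C, U) U' * F (merge U U').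
  under eq_bigr do rewrite mulr_suml.
  rewrite exchange_big; apply: eq_bigr => U _ /=.
  under eq_bigr do rewrite -mulrA mulr_suml.
  rewrite -mulr_sumr exchange_big; congr (_ * _); apply: eq_bigr => U' _ /=.
  rewrite (bigD1 (merge U U')) //= eqxx mulr1 big1 ?addr0 // => V.
  by rewrite eq_sym => /negbTE ->; rewrite mulr0 mul0r.
have sumOW' (F : O -> R) : \sum_o W' o * F o =
    \sum_o W o * \sum_U' rho o U' * F (o.1, merge o.2 U').
  rewrite !sumO; apply: eq_bigr => C _; exact: (sumW' C (fun U => F (C, U))).
have rho1 o c : \sum_U rho o U * c = c.
  by rewrite -mulr_suml; have [[_ -> _] _] := rhoP o; rewrite mul1r.
have new_old v C U U' : reached P v -> new_cnt (C, merge U U') v = new_cnt (C, U) v.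
  by move=> rv; rewrite /new_cnt inE not_child.
have new_child v C U U' : child_of v p ->
    new_cnt (C, merge U U') v = (b v + (v \in U'))%N.
  by move=> cv; rewrite /new_cnt inE cv.
have dev_old v : reached P v -> dev W' v = dev W v.
  move=> rv; rewrite /dev sumOW'; apply: eq_bigr => -[C U] _; congr (_ * _).
  by under eq_bigr do rewrite /= new_old //; rewrite rho1.
(* Old counts are integers, so the rounding costs nothing in expectation. *)
have dev_child v : child_of v p ->
    dev W' v = \sum_o W o * `|(b v)%:R + z o v - (cnt o.1 v)%:R|.
  move=> cv; rewrite /dev sumOW'; apply: eq_bigr => -[C U] _; congr (_ * _).
  under eq_bigr do rewrite /= new_child // natrD.
  by have [rP _] := rhoP (C, U); rewrite (set_dist_norm _ _ rP).
have reachedU v : reached (p |: P) v -> reached P v \/ child_of v p.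
  case=> [->|]; first by left; left.
  rewrite in_setU1 => /orP[/eqP vp|vP]; last by left; right.
  have [->|vr] := eqVneq v (root T); first by left; left.
  by right; rewrite /child_of vr vp eqxx.
exists W'; split.
- split=> [o|C].
    apply: sumr_ge0 => U _; rewrite mulr_ge0 //; apply: sumr_ge0 => U' _.
    by have [[r0 _ _] _] := rhoP (o.1, U); rewrite mulr_ge0.
  rewrite -Wmu; have := sumW' C (fun=> 1).
  under eq_bigr do rewrite mulr1.
  by move=> ->; apply: eq_bigr => U _; rewrite rho1 mulr1.
- have widen v : reached P v -> reached (p |: P) v.
    by case=> [|vP]; [left|right; rewrite in_setU1 vP orbT].
  by move=> q; rewrite in_setU1 => /orP[/eqP ->|/Pcl]; exact: widen.
- move=> v /reachedU[rv|cv].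
    rewrite -Wmean // sumOW'; apply: eq_bigr => -[C U] _; congr (_ * _).
    by under eq_bigr do rewrite /= new_old //; rewrite rho1.
  have := zcol v; rewrite /b' /y' cv => <-; rewrite sumOW'.
  apply: eq_bigr => -[C U] _; congr (_ * _).
  under eq_bigr do rewrite /= new_child // natrD mulrDr.
  rewrite big_split /= rho1; congr (_ + _).
  by have [[_ _ ->] _] := rhoP (C, U).
- move=> [C V] Wo.
  have [U WU [U' rU' <-]] : exists2 U, W (C, U) != 0 &
      exists2 U', rho (C, U) U' != 0 & merge U U' = V.
    apply: contrapT => nex; move/negP: Wo; apply; apply/eqP; rewrite /W' big1 // => U _.
    have [->|WU] := eqVneq (W (C, U)) 0; first by rewrite mul0r.
    rewrite big1 ?mulr0 // => U' _ /=.
    have [->|rU'] := eqVneq (rho (C, U) U') 0; first by rewrite mul0r.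
    case: eqP => [mV|_]; last by rewrite mulr0.
    by case: nex; exists U => //; exists U'.
  have [rk rP] := Wsupp _ WU; split; first by rewrite new_old //; left.
  move=> q; rewrite in_setU1 => /orP[/eqP ->|qP].
    rewrite new_old //; have [_ /(_ WU _ rU') <-] := rhoP (C, U).
    by apply: eq_bigr => v cv; rewrite new_child.
  rewrite new_old; last exact: Pcl.
  rewrite -rP //; apply: eq_bigr => v /andP[_ /eqP vq].
  by rewrite new_old //; right; rewrite vq.
- move=> q; rewrite in_setU1 => /orP[/eqP ->|qP]; last first.
    rewrite (dev_old q); last exact: Pcl.
    apply: le_trans (Wcost q qP); rewrite le_eqVlt; apply/orP; left; apply/eqP.
    by apply: eq_bigr => v /andP[_ /eqP vq]; apply: dev_old; right; rewrite vq.
  rewrite (dev_old p) // (eq_bigr _ dev_child).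
  have -> : dev W p = \sum_o W o * `|(new_cnt o p)%:R - \sum_v (n o v)%:R|.
    apply: eq_bigr => o _; congr (_ * `|_ - _|).
    rewrite cntE mass_children // big_mkcond; apply: eq_bigr => v _.
    by rewrite /n; case: ifP => // _; rewrite cntE.
  have -> : \sum_(v | child_of v p) `|mass y v - mass x v| =
      \sum_v `|y' v - \sum_o W o * (n o v)%:R|.
    rewrite big_mkcond; apply: eq_bigr => v _; rewrite /y' /n; case: ifP => _.
      by rewrite (sum_marginal (fun C => (cnt C v)%:R) Wmu) mean_cnt.
    by rewrite big1 ?subrr ?normr0 // => o _; rewrite mulr0.
  apply: le_trans zcost; rewrite big_mkcond; apply: ler_sum => v _.
  rewrite /b' /n; case: ifP => _ //.
  by apply: sumr_ge0 => o _; rewrite mulr_ge0.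
Qed.

(** Internal nodes are processed by increasing depth: a shallowest remaining node is the root or has
    a processed parent. *)
Lemma full_coupling : exists W, partial_coupling W [set v | ~~ is_leaf v].
Proof.
set I := [set v | ~~ is_leaf v].
suff ext n W P : (#|I :\: P| < n)%N -> P \subset I -> partial_coupling W P ->
    exists W', partial_coupling W' I.
  have [W WP] := partial_coupling0; apply: (ext _ W finset.set0 (ltnSn _) _ WP).
  exact: finset.sub0set.
elim: n W P => // n IHn W P ltn PI WP; have [IP|[v0 v0I]] := set_0Vmem (I :\: P).
  suff <- : P = I by exists W.
  by apply/eqP; rewrite finset.eqEsubset PI -finset.setD_eq0 IP eqxx.
case: (@arg_minnP _ v0 (mem (I :\: P)) (@depth R T) v0I) => p pI pmin.
move: (pI); rewrite !inE => /andP[pP np].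
have rp : reached P p.
  have [->|pr] := eqVneq p (root T); first by left.
  right; apply: contraT => ppP.
  have /pmin : parent p \in I :\: P.
    rewrite !inE ppP; apply/negP => /forallP/(_ p).
    by rewrite /child_of pr eqxx.
  rewrite depth_parent.
  have : depth p != 0%N by apply: contra pr => /eqP/depth0 ->.
  lia.
have [W' W'P] := partial_coupling_step WP pP np rp; apply: IHn W'P.
  rewrite ltnS in ltn; apply: leq_trans ltn.
  by rewrite finset.setUC -finset.setDDl [ltnRHS](cardsD1 p) !inE pP np.
by rewrite finset.subUset finset.sub1set PI inE np.
Qed.

(** As [b] is 0 at leaves, the new count of a leaf is its membership in [U]. *)
Definition new_config (U : {set node T}) : {set leaf T} := [set i | val i \in U].

(** Both sides agree at the leaves and are additive over children, so they agree by induction from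
    the bottom up. *)
Lemma new_config_cnt W o v : partial_coupling W [set v | ~~ is_leaf v] ->
  W o != 0 -> cnt (new_config o.2) v = new_cnt o v.
Proof.
move=> [_ _ _ Wsupp _] Wo; have [_ Wch] := Wsupp o Wo.
pose M := (\max_(v : node T) depth v)%N.
have [n] := ubnP (M - depth v); elim: n v => // n IHn v ltn.
have [lv|nv] := boolP (is_leaf v).
  rewrite /new_cnt (b_leaf lv); apply/eqP; rewrite -(eqr_nat R) cntE.
  by rewrite (mass_leaf _ (Sub v lv)) /indicator inE SubK.
rewrite -Wch ?inE //; apply/eqP; rewrite -(eqr_nat R) cntE mass_children // natr_sum.
apply/eqP; apply: eq_bigr => w /andP[wr /eqP wv]; rewrite -cntE IHn //.
have := @leq_bigmax _ (@depth R T) w; rewrite -/M => wM.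
have := depth_parent w; rewrite wv.
have : depth w != 0%N by apply: contra wr => /eqP/depth0 ->.
lia.
Qed.

Variable sigma : R.
Hypothesis sigma_gt1 : 1 < sigma.
Hypothesis hst : is_HST T sigma.

(* Summed over [p] with the weights of the child edges, the local bounds of a
   coupling charge each node at most a [sigma]-th of its own contribution. *)
Lemma coupling_cost W : partial_coupling W [set v | ~~ is_leaf v] ->
  \sum_(v | v != root T) len v * dev W v <=
  2 * sigma / (sigma - 1) * tree_norm x y.
Proof.
move=> WP; have [[W0 Wmu] _ _ Wsupp Wcost] := WP.
have [mu0 muk mu1] := mu_state; have [same ratio] := hst.
have dev0 v : 0 <= dev W v by apply: sumr_ge0 => o _; rewrite mulr_ge0.
have dev_root : dev W (root T) = 0.
  apply: big1 => o _; have [->|Wo] := eqVneq (W o) 0; first by rewrite mul0r.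
  have [-> _] := Wsupp o Wo; rewrite cnt_root.
  have [->|/eqP ck] := eqVneq #|o.1| k; first by rewrite subrr normr0 mulr0.
  by have := partial_coupling_support WP Wo; rewrite muk ?eqxx.
set tot := (X in X <= _); set tn := tree_norm x y.
(* The child edges share one length, which is [len p / sigma] below a non-root node; the root
   contributes nothing since its count is always [k]. *)
have local p : \sum_(v | child_of v p) len v * dev W v <=
    (if p != root T then len p / sigma * dev W p else 0) +
    2 * \sum_(v | child_of v p) len v * `|mass x v - mass y v|.
  have sig0 : 0 < sigma := lt_trans ltr01 sigma_gt1.
  have [lp|np] := boolP (is_leaf p).
    have nc v : child_of v p = false by apply/negbTE; move/forallP: lp.
    rewrite !big_pred0 // mulr0 addr0; case: ifP => // pr.
    by rewrite mulr_ge0 // divr_ge0 ?len_ge0 ?ltW.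
  have [c cp] : exists c, child_of c p.
    by move: np; rewrite negb_forall => /existsP[c]; rewrite negbK; exists c.
  have lc v : child_of v p -> len v = len c by move=> vp; exact: same vp cp.
  have c0 : 0 <= len c by apply: len_ge0; case/andP: cp.
  rewrite (eq_bigr (fun v => len c * dev W v)); last by move=> v /lc ->.
  rewrite [X in _ + 2 * X](eq_bigr (fun v => len c * `|mass y v - mass x v|)).
    rewrite -!mulr_sumr mulrCA.
    apply: le_trans (ler_wpM2l c0 (Wcost p _)) _; first by rewrite inE.
    rewrite mulrDr lerD2r; case: eqVneq => [->|pr]; first by rewrite dev_root mulr0.
    by rewrite (ratio p c pr cp) [sigma * _]mulrC mulfK // gt_eqF.
  by move=> v /lc ->; rewrite distrC.
have by_parent (F : node T -> R) :
    \sum_(v | v != root T) F v = \sum_p \sum_(v | child_of v p) F v.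
  by rewrite (partition_big (@parent R T) xpredT).
(* Solving this self-bounding inequality for [tot] yields the constant. *)
have tot_le : tot <= tot / sigma + 2 * tn.
  rewrite {1}/tot by_parent (le_trans (ler_sum _ (fun p _ => local p))) //.
  rewrite big_split /= -mulr_sumr -by_parent -/tn lerD2r -big_mkcond.
  rewrite /tot mulr_suml le_eqVlt; apply/orP; left; apply/eqP.
  by apply: eq_bigr => v _; ring.
have s1 : 0 < sigma - 1 by rewrite subr_gt0.
rewrite mulrAC ler_pdivlMr // mulrBr mulr1.
have := ler_wpM2r (ltW (lt_trans ltr01 sigma_gt1)) tot_le.
by rewrite mulrDl divfK ?gt_eqF ?(lt_trans ltr01) //; lra.
Qed.

(** The atoms are pushed forward to pairs of configurations; [matching_cost_le] bounds each pair by
    its count changes, whose weighted means [coupling_cost] controls. *)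
Lemma coupling_step : exists nu : {set leaf T} -> R,
  [/\ rand_state k nu, consistent nu y,
      forall C v, nu C != 0 -> (b v <= cnt C v <= (b v).+1)%N &
      modification_cost mu nu <= 2 * sigma / (sigma - 1) * tree_norm x y].
Proof.
have [W WP] := full_coupling; have [[W0 Wmu] _ Wmean Wsupp _] := WP.
have [mu0 muk mu1] := mu_state.
pose w C D := \sum_U W (C, U) * (new_config U == D)%:R.
pose nu D := \sum_C w C D.
have sumw C (F : {set leaf T} -> R) :
    \sum_D w C D * F D = \sum_U W (C, U) * F (new_config U).
  under eq_bigr do rewrite mulr_suml.
  rewrite exchange_big; apply: eq_bigr => U _ /=.
  rewrite (bigD1 (new_config U)) //= eqxx mulr1 big1 ?addr0 // => D.
  by rewrite eq_sym => /negbTE ->; rewrite mulr0 mul0r.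
have sumnu (F : {set leaf T} -> R) :
    \sum_D nu D * F D = \sum_o W o * F (new_config o.2).
  under eq_bigr do rewrite mulr_suml.
  by rewrite exchange_big sumO; apply: eq_bigr => C _; rewrite sumw.
have w0 C D : 0 <= w C D by apply: sumr_ge0 => U _; rewrite mulr_ge0.
have supp D : nu D != 0 -> exists2 o, W o != 0 & new_config o.2 = D.
  move=> nuD; apply: contrapT => nex; move/negP: nuD; apply; apply/eqP.
  rewrite /nu big1 // => C _; rewrite /w big1 // => U _.
  have [->|WU] := eqVneq (W (C, U)) 0; first by rewrite mul0r.
  by case: eqP => [e|_]; [case: nex; exists (C, U)|rewrite mulr0].
exists nu; split.
- split=> [D|D|]; first by apply: sumr_ge0 => C _.
    move=> Dk; apply: contrapT => /eqP/supp[o Wo oD]; apply: Dk.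
    rewrite -cnt_root -oD (new_config_cnt _ WP Wo).
    by case: (Wsupp o Wo).
  have := sumnu (fun=> 1); under eq_bigr do rewrite mulr1.
  move=> ->; rewrite sumO -[RHS]mu1; apply: eq_bigr => C _.
  by rewrite -Wmu; apply: eq_bigr => U _; rewrite mulr1.
- move=> i; rewrite -[RHS](mass_leaf y i) -Wmean; last first.
    have [ir|ir] := eqVneq (val i) (root T); [by left|right].
    rewrite inE; apply/negP => /forallP/(_ (val i)).
    by rewrite /child_of ir eqxx.
  have -> : \sum_(C : {set leaf T} | i \in C) nu C =
      \sum_(C : {set leaf T}) nu C * (i \in C)%:R.
    by rewrite big_mkcond; apply: eq_bigr => C _; case: ifP; rewrite ?mulr1 ?mulr0.
  rewrite (sumnu (fun C : {set leaf T} => (i \in C)%:R)); apply: eq_bigr => o _.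
  by rewrite /new_cnt b_leaf ?(valP i) // inE.
- move=> D v /supp[o Wo <-]; rewrite (new_config_cnt _ WP Wo) /new_cnt.
  by case: (v \in _) => /=; lia.
apply: le_trans (coupling_cost WP).
have cw : is_coupling mu nu w.
  split=> // C; rewrite -[RHS]Wmu; have := sumw C (fun=> 1).
  under eq_bigr do rewrite mulr1.
  by move=> ->; apply: eq_bigr => U _; rewrite mulr1.
apply: le_trans (transport_cost_le (@matching_cost_ge0 R T) cw) _.
under eq_bigr do rewrite sumw.
rewrite -(sumO (fun o => W o * matching_cost o.1 (new_config o.2))).
under [leRHS]eq_bigr do rewrite mulr_sumr.
rewrite exchange_big; apply: ler_sum => o _ /=.
have [->|Wo] := eqVneq (W o) 0.
  by rewrite mul0r big1 // => v _; rewrite mul0r mulr0.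
under eq_bigr do rewrite mulrCA.
rewrite -mulr_sumr ler_wpM2l //.
apply: le_trans (matching_cost_le _) _.
  have [rk _] := Wsupp o Wo; rewrite -[RHS]cnt_root (new_config_cnt _ WP Wo) rk.
  have [//|/eqP ck] := eqVneq #|o.1| k.
  by have := partial_coupling_support WP Wo; rewrite muk ?eqxx.
rewrite le_eqVlt; apply/orP; left; apply/eqP; apply: eq_bigr => v vr.
by rewrite distrC -!cntE (new_config_cnt _ WP Wo).
Qed.

End Step.

(** * The online procedure *)

Section Procedure.
Context {R : realType} (T : wtree R) (k : nat) (sigma : R).
Hypothesis sigma_gt1 : 1 < sigma.
Hypothesis hst : is_HST T sigma.
Implicit Types (x y : leaf T -> R) (mu nu : {set leaf T} -> R).

Definition balanced mu : Prop := exists a : node T -> nat,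
  forall C v, mu C != 0 -> (a v <= cnt C v <= (a v).+1)%N.

Definition valid mu x : Prop :=
  [/\ rand_state k mu, consistent mu x & balanced mu].

Lemma valid_step mu x y : frac_state k x -> frac_state k y -> valid mu x ->
  exists nu, valid nu y /\
    modification_cost mu nu <= 2 * sigma / (sigma - 1) * movement_cost x y.
Proof.
move=> xs ys [ms mx [a mbal]]; have [y01 _] := ys.
(* The floor of the mass, except at leaves: a leaf of mass 1 still gets 0, which the closed upper
   bound permits. *)
have /choice[b bP] v : exists b : nat,
    ((b%:R <= mass y v <= b%:R + 1) /\ (is_leaf v -> b = 0%N)).
  have y0 : 0 <= mass y v by apply: mass_ge0 => i; case/andP: (y01 i).
  have [lv|_] := boolP (is_leaf v).
    by exists 0%N; rewrite add0r (mass_leaf _ (Sub v lv)).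
  exists (Num.truncn (mass y v)); split=> //; have := truncn_itv y0.
  by rewrite -natr1 => /andP[-> /ltW ->].
have [nu [ns ny nbal cost]] := coupling_step ys ms mx mbal
  (fun v => (bP v).1) (fun v => (bP v).2) sigma_gt1 hst.
exists nu; split; first by split=> //; exists b.
apply: le_trans cost _; rewrite ler_wpM2l ?(tree_norm_le_movement xs ys) //.
by have s1 := sigma_gt1; rewrite divr_ge0 ?mulr_ge0 //; lra.
Qed.

Lemma valid_init x : initial_state k x -> exists mu, valid mu x.
Proof.
move=> [C Ck xE]; exists (fun D => (D == C)%:R); split.
- split=> [D|D Dk|]; first exact: ler0n.
    by case: eqP => // DC; rewrite DC Ck in Dk.
  by rewrite (bigD1 C) //= eqxx big1 ?addr0 // => D /negbTE ->.
- move=> i; rewrite xE /indicator big_mkcond (bigD1 C) //= eqxx big1 ?addr0.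
    by case: ifP.
  by move=> D /negbTE ->; case: ifP.
exists (cnt C) => D v; case: (D =P C) => [-> _|_]; last by rewrite eqxx.
by rewrite leqnn leqnSn.
Qed.

Definition start x : {set leaf T} -> R := xget (fun=> 0) [set mu | valid mu x]%classic.

(** Choosing a witness of [valid_step] makes the next state a function of the current one and of two
    fractional states, hence online. *)
Definition update x y mu : {set leaf T} -> R :=
  xget mu [set nu | valid nu y /\
    modification_cost mu nu <= 2 * sigma / (sigma - 1) * movement_cost x y]%classic.

(* The most recent state comes first. *)
Fixpoint run (s : seq (leaf T -> R)) : {set leaf T} -> R :=
  if s is y :: s' then
    if s' is x :: _ then update x y (run s') else start y
  else fun=> 0.

Lemma updateP x y mu : frac_state k x -> frac_state k y -> valid mu x ->
  valid (update x y mu) y /\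
  modification_cost mu (update x y mu) <=
    2 * sigma / (sigma - 1) * movement_cost x y.
Proof.
move=> xs ys mx; have [nu nuP] := valid_step xs ys mx.
exact: (@xgetPex _ mu [set nu | valid nu y /\
    modification_cost mu nu <= 2 * sigma / (sigma - 1) * movement_cost x y]%classic
  (ex_intro _ nu nuP)).
Qed.

Lemma startP x : initial_state k x -> valid (start x) x.
Proof.
move=> /valid_init[mu muP].
exact: (@xgetPex _ (fun=> 0) [set mu | valid mu x]%classic (ex_intro _ mu muP)).
Qed.

End Procedure.

Theorem theorem5p1 (R : realType) (sigma : R) (hsigma : 5 < sigma) :
  exists K : R, 0 < K /\
  forall (T : wtree R) (k : nat), is_HST T sigma ->
  exists proc : seq (leaf T -> R) -> ({set leaf T} -> R),
  forall x : nat -> leaf T -> R,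
  (forall t, frac_state k (x t)) ->
  initial_state k (x 0%N) ->
  let S := fun t : nat => proc (mkseq x t.+1) in
  (forall t, rand_state k (S t) /\ consistent (S t) (x t)) /\
  (forall t, modification_cost (S t) (S t.+1)
             <= K * movement_cost (x t) (x t.+1)).
Proof.
have sigma_gt1 : 1 < sigma by lra.
exists (2 * sigma / (sigma - 1)); split.
  by rewrite divr_gt0 ?mulr_gt0 //; lra.
(* [mkseq] lists the history chronologically, whereas [run] recurses from the latest state. *)
move=> T k hst; exists (fun s => run k sigma (rev s)) => x xs x0 S.
have SS t : S t.+1 = update k sigma (x t) (x t.+1) (S t).
  by rewrite /S !mkseqS !rev_rcons.
have valS t : valid k (S t) (x t).
  elim: t => [|t IHt]; first exact: startP.
  by rewrite SS; case: (updateP sigma_gt1 hst (xs t) (xs t.+1) IHt).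
split=> t; first by case: (valS t).
by rewrite SS; case: (updateP sigma_gt1 hst (xs t) (xs t.+1) (valS t)).
Qed.
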